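(* Let $k$ and $\ell$ be positive integers with $k/2\le \ell<k$. Let $G$ be an oriented graph such that \[\delta^0(G)\ge \begin{cases} k-\frac{\ell}{2} & \text{if } \ell\le \frac{2k}{3},\\ \frac{2k}{3} & \text{if } \ell>\frac{2k}{3}.\end{cases}\] Then $G$ contains as a subgraph both possible $k$-arc oriented paths with two blocks of size $\ell$ and $k-\ell$, i.e. $G$ contains $P(\overleftarrow{\ell},\overrightarrow{k-\ell})$ and $G$ contains $P(\overrightarrow{\ell},\overleftarrow{k-\ell})$.
   Context: An oriented graph is a digraph with no directed cycles of length one or two (no loops, at most one arc between any two distinct vertices, in at most one direction). Digraphs are finite with nonempty vertex set. The minimum semidegree $\delta^0(G)$ is the minimum value among the in-degrees and out-degrees of all vertices of $G$. An oriented path is an orientation of an undirected path (all vertices distinct). A directed path is an oriented path in which all arcs have the same direction. A block of an oriented path is a maximal directed subpath, and its size is the number of its arcs. For integers $r,s\ge 1$, $P(\overleftarrow{r},\overrightarrow{s})$ denotes the two-block path with $r+s$ arcs on distinct vertices $p_0,p_1,\dots,p_{r+s}$ whose first $r$ arcs are backward, i.e. $(p_{i+1},p_i)$ for $0\le i<r$, and whose last $s$ arcs are forward, i.e. $(p_i,p_{i+1})$ for $r\le i<r+s$. Similarly, $P(\overrightarrow{r},\overleftarrow{s})$ has first $r$ arcs forward, $(p_i,p_{i+1})$ for $0\le i<r$, and last $s$ arcs backward, $(p_{i+1},p_i)$ for $r\le i<r+s$. $G$ contains an oriented path $P$ (as a not necessarily induced subgraph) if there is an injective map $f:V(P)\to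 V(G)$ such that $(f(u),f(v))$ is an arc of $G$ for every arc $(u,v)$ of $P$. *)

(* Defs.v *)
From mathcomp Require Import all_boot all_order all_algebra.
Set Implicit Arguments.
Unset Strict Implicit.
Unset Printing Implicit Defensive.

(* A digraph on a finite vertex type T is a relation e : rel T, where e x y
   means that (x, y) is an arc; loops and 2-cycles are a priori allowed. *)

Definition oriented_graph (T : finType) (e : rel T) : Prop :=
  irreflexive e /\ (forall x y : T, e x y -> ~~ e y x).

Definition outdeg (T : finType) (e : rel T) (x : T) : nat := #|[set y | e x y]|.

Definition indeg (T : finType) (e : rel T) (x : T) : nat := #|[set y | e y x]|.

(* All degrees are at most #|T|, so for nonempty T the default value #|T| does
   not affect the minimum. *)
Definition min_semidegree (T : finType) (e : rel T) : nat :=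
  \big[Order.min/#|T|]_(x : T) Order.min (indeg e x) (outdeg e x).

(* The vertex p_i is the ordinal i; each disjunct describes the arcs of one
   block, [path_bf] being backward then forward, [path_fb] the other way. *)
Definition path_bf (r s : nat) : rel 'I_(r + s).+1 :=
  fun u v => ((v < r) && (u == v.+1 :> nat)) || ((r <= u) && (v == u.+1 :> nat)).

Definition path_fb (r s : nat) : rel 'I_(r + s).+1 :=
  fun u v => ((u < r) && (v == u.+1 :> nat)) || ((r <= v) && (u == v.+1 :> nat)).

(* Not necessarily induced subgraph containment. *)
Definition contains (T U : finType) (e : rel T) (p : rel U) : Prop :=
  exists f : U -> T, injective f /\ forall u v : U, p u v -> e (f u) (f v).

(* Main.v *)
Require Import Defs.
From mathcomp Require Import all_boot all_order all_algebra zify lra.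
From Stdlib Require Import Classical_Prop.

(** Write k = l + s with s <= l, and let d be the minimum semidegree; in
    integers the hypotheses say 2 k <= 3 d and l + 2 s <= 2 d.  Reversing all
    arcs exchanges the two kinds of path, so it is enough to find a spider: a
    vertex from which two directed paths leave, of lengths l and s, disjoint
    apart from it.

    Suppose that there is none, and let g 0, ..., g m be a longest directed
    path.  All in-neighbours of its start and all out-neighbours of its end lie
    on it.  An arc g h -> g 0 makes g h the centre of a spider with legs
    g 0 .. g (h-1) and g (h+1) .. g m, so the absence of spiders restricts the
    positions of the at least d in-neighbours of g 0 ([start_avoid]).  The
    same restriction holds for every longest path, and more of them come from
    rotations: if g m -> g j and g i -> g 0 with j <= i, then
        g (i+1) .. g m, g j .. g i, g 0 .. g (j-1)
    is again a directed path on the same vertices ([dipath_rot]).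

    The contradiction is reached in three stages.
    - m >= 2 d, a theorem of Jackson ([longest_ge_2d]).  A vertex that is both
      the start of one longest path and the end of another one on the same
      vertices has 2 d distinct neighbours on it, whence m >= 2 d.
      If m < 2 d this forbids certain pairs of an in-neighbour of g 0 and an
      out-neighbour of g m, and a count leaves too few neighbours.
    - m + 1 >= 2 l ([longest_ge_2l]).  Otherwise at most 2 k - m - 2 positions
      are left for the in-neighbours of g 0, so that d <= 2 k - 2 d - 2,
      against 2 k <= 3 d.
      Hence no in-neighbour of the start of a longest path has its
      position in [s, m - s].
    - No longest path closes into a cycle ([not_hamiltonian]): otherwise all
      neighbours of g 0 would be at cyclic distance at most s, so that
      d <= s, against l + 2 s <= 2 d.  But such a cycle exists
      ([no_spider_no_longest]): at least d - s + 1 in-neighbours of g 0 are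
      among the last s vertices, symmetrically at least d - s + 1
      out-neighbours of g m are among the first s, and 2 (d - s + 1) > s yields t with g (m - t) -> g 0 and g m -> g t.
      Rotating there moves g (m - t + 1) to the start without moving the middle
      of the path, so that the in-neighbours of g (m - t + 1) also avoid the
      middle, and a second pigeonhole gives q with g q -> g (m - t + 1)
      and g m -> g (q + 1).  This closes a cycle through all the vertices. *)

(** * Counting the indices in an interval that satisfy a predicate *)

Section Counting.
Implicit Types (P Q : pred nat) (a b c : nat).

Definition cnt P a b : nat := \sum_(a <= i < b) P i.

Lemma cnt_cat P a b c : a <= b -> b <= c -> cnt P a c = cnt P a b + cnt P b c.
Proof. exact: big_cat_nat. Qed.

Lemma cnt_disjoint P Q a b c :
    (forall i, a <= i < b -> P i -> Q (i + c) -> False) ->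
  cnt P a b + cnt Q (a + c) (b + c) <= b - a.
Proof.
move=> PQ; rewrite /cnt big_addn addnK addnC.
rewrite -[b - a]muln1 -sum_nat_const_nat -big_split /= !big_nat.
apply: leq_sum => i /PQ; case: (P i) (Q _) => [] [] // => h.
by case: h.
Qed.

Lemma cnt_le P a b : cnt P a b <= b - a.
Proof.
have := @cnt_disjoint P pred0 a b 0 (fun _ _ _ => notF).
by apply: leq_trans; exact: leq_addr.
Qed.

Lemma cnt_eq0 P a b : (forall i, a <= i < b -> ~~ P i) -> cnt P a b = 0.
Proof. by move=> nP; rewrite /cnt big_nat big1 // => i /nP/negbTE ->. Qed.

Lemma cnt_lt P a b r : a <= r < b -> ~~ P r -> cnt P a b < b - a.
Proof.
move=> /andP[le_ar lt_rb] nPr.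
have := cnt_cat P a r b le_ar (ltnW lt_rb).
have := cnt_cat P r r.+1 b (leqnSn _) lt_rb.
have := cnt_le P a r; have := cnt_le P r.+1 b.
have : cnt P r r.+1 = 0 by apply: cnt_eq0 => i hi; have -> : i = r by [lia].
lia.
Qed.

Lemma cnt_meet P Q a b c : b - a < cnt P a b + cnt Q (a + c) (b + c) ->
  exists2 i, a <= i < b & P i /\ Q (i + c).
Proof.
have [/hasP[i]|/hasPn nPQ] :=
    boolP (has (fun i => P i && Q (i + c)) (index_iota a b)).
  by rewrite mem_index_iota => ? /andP[? ?] _; exists i.
rewrite ltnNge cnt_disjoint // => i hi Pi Qi; have := nPQ i.
by rewrite mem_index_iota hi Pi Qi => /(_ isT).
Qed.

Lemma cnt_gt0 P a b : 0 < cnt P a b -> exists2 i, a <= i < b & P i.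
Proof.
have [/hasP[i]|/hasPn nP] := boolP (has P (index_iota a b)).
  by rewrite mem_index_iota; exists i.
by rewrite cnt_eq0 // => i hi; apply: nP; rewrite mem_index_iota.
Qed.

Lemma cnt_rev P m s : s <= m.+1 ->
  cnt P (m.+1 - s) m.+1 = cnt (fun t => P (m - t)) 0 s.
Proof.
move=> le_sm; rewrite /cnt big_nat_rev -{1}[m.+1 - s]add0n big_addn subKn //.
by apply: eq_big_nat => i lt_is; congr (nat_of_bool (P _)); lia.
Qed.

Lemma cnt_exclusive P Q n r : r <= n -> ~~ P r -> ~~ Q r ->
    (forall i, P i -> Q i -> False) ->
  cnt P 0 n.+1 + cnt Q 0 n.+1 <= n.
Proof.
move=> le_rn nPr nQr PQ.
have D a b : cnt P a b + cnt Q a b <= b - a.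
  have := @cnt_disjoint P Q a b 0; rewrite !addn0; apply=> i _.
  by rewrite addn0; exact: PQ.
have P0 : cnt P r r.+1 = 0 by apply: cnt_eq0 => i hi; have -> : i = r by [lia].
have Q0 : cnt Q r r.+1 = 0 by apply: cnt_eq0 => i hi; have -> : i = r by [lia].
have le_rn1 : r <= n.+1 by lia.
have := cnt_cat P 0 r n.+1 (leq0n _) le_rn1.
have := cnt_cat Q 0 r n.+1 (leq0n _) le_rn1.
have := cnt_cat P r r.+1 n.+1 (leqnSn _) le_rn.
have := cnt_cat Q r r.+1 n.+1 (leqnSn _) le_rn.
have := D 0 r; have := D r.+1 n.+1.
lia.
Qed.

(** The count behind [longest_ge_2d]: a is the last index in P, b the first one
    in Q.  On the common range [b, a] the index i of P is matched with i + 2 of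
    Q.  This leaves a - 1 and a in P, b and b + 1 in Q unmatched, so the range
    may count 2 more than its length; the zeros of P at 0 and 1 and of Q at m
    save 3. *)
Lemma cnt_interleaved P Q m a b :
    (forall i, P i -> 2 <= i <= a) -> (forall i, Q i -> b <= i < m) ->
    (b <= a -> 2 <= b /\ a < m) -> 0 < b <= m -> 2 <= a <= m ->
    (forall i, b <= i -> i + 2 <= a -> P i -> Q (i + 2) -> False) ->
  cnt P 0 m.+1 + cnt Q 0 m.+1 <= m.
Proof.
move=> Pa Qb ab b_m a_m PQ.
have C R x y z : x <= y <= z -> cnt R x z = cnt R x y + cnt R y z.
  by case/andP; exact: cnt_cat.
have zP x y : y <= 2 \/ a < x -> cnt P x y = 0.
  by move=> xy; apply: cnt_eq0 => i hi; apply/negP => /Pa; lia.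
have zQ x y : y <= b \/ m <= x -> cnt Q x y = 0.
  by move=> xy; apply: cnt_eq0 => i hi; apply/negP => /Qb; lia.
have := C P 0 2 m.+1; have := C P 2 a.+1 m.+1.
have := zP 0 2; have := zP a.+1 m.+1.
have := C Q 0 b m.+1; have := C Q b m m.+1.
have := zQ 0 b; have := zQ m m.+1.
have [/[dup] le_ba /ab [ge2 ltm]|lt_ab] := leqP b a; last first.
  by have := cnt_le P 2 a.+1; have := cnt_le Q b m; lia.
have := C P 2 b a.+1; have := C Q b a.+1 m.
have := cnt_le P 2 b; have := cnt_le Q a.+1 m.
have [eq_ab|ne_ab] := eqVneq a b.
  have := cnt_le P b a.+1; have := cnt_le Q b a.+1; lia.
have := C P b a.-1 a.+1; have := C Q b (b + 2) a.+1.
have := cnt_le P a.-1 a.+1; have := cnt_le Q b (b + 2).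
have := cnt_disjoint P Q b a.-1 2; have -> : a.-1 + 2 = a.+1 by lia.
have PQ' i : b <= i < a.-1 -> P i -> Q (i + 2) -> False.
  by move=> hi; apply: PQ; lia.
move/(_ PQ'); lia.
Qed.

End Counting.

(** * Directed paths and their rotations *)

Section Paths.
Variables (T : finType) (e : rel T).
Hypotheses (e_irr : irreflexive e) (e_asym : forall x y, e x y -> ~~ e y x).

(** A path is a function on all naturals of which only the values at 0, ..., m
    matter, so that reindexing it is plain composition. *)
Definition dipath m (g : nat -> T) : Prop :=
  (forall i, i < m -> e (g i) (g i.+1)) /\
  (forall i j, i <= m -> j <= m -> g i = g j -> i = j).

(** The index map whose values are i+1 .. m, then j .. i, then 0 .. j-1. *)
Definition rotidx m i j t :=
  if t < m - i then t + i.+1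
  else if t <= m - j then t - (m - i) + j else t - (m - j).+1.

Lemma rotidx_le m i j t : j <= i <= m -> t <= m -> rotidx m i j t <= m.
Proof. rewrite /rotidx; do ?case: ifPn; lia. Qed.

Lemma rotidx0 m i j : j <= i < m -> rotidx m i j 0 = i.+1.
Proof. rewrite /rotidx; do ?case: ifPn; lia. Qed.

Lemma rotidxm m i j : 0 < j <= i -> i <= m -> rotidx m i j m = j.-1.
Proof. rewrite /rotidx; do ?case: ifPn; lia. Qed.

(** The new arcs g m -> g j and g i -> g 0 link consecutive blocks; the
    conditions on them account for a first or a last block that is empty.  With
    i = m and j > 0 this is the cyclic shift of a closed path. *)
Lemma dipath_rot {m g i j} : dipath m g -> j <= i <= m ->
    (i < m -> e (g m) (g j)) -> (0 < j -> e (g i) (g 0)) ->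
  dipath m (g \o rotidx m i j).
Proof.
move=> [arc inj] le_ji emj ei0; split=> [t lt_tm | t u le_t le_u /= /inj].
  rewrite /= /rotidx.
  have [? | ? ] := ltnP t (m - i).
    have [?|?] := ltnP t.+1 (m - i); first by rewrite addSn; apply: arc; lia.
    have -> : t.+1 <= m - j by lia.
    have -> : t + i.+1 = m by lia.
    have -> : t.+1 - (m - i) + j = j by lia.
    by apply: emj; lia.
  have -> : (t.+1 < m - i) = false by lia.
  have [?|?] := ltnP t (m - j).
    rewrite ltnW // (_ : t.+1 - _ + j = (t - (m - i) + j).+1); last by lia.
    by apply: arc; lia.
  have [?|?] := leqP t (m - j).
    have -> : t.+1 - (m - j).+1 = 0 by lia.
    have -> : t - (m - i) + j = i by lia.
    by apply: ei0; lia.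
  rewrite (_ : t.+1 - _ = (t - (m - j).+1).+1); last by lia.
  by apply: arc; lia.
move/(_ (rotidx_le _ _ _ _ le_ji le_t) (rotidx_le _ _ _ _ le_ji le_u)).
rewrite /rotidx; do ?case: ifPn; lia.
Qed.

(** The centre is g h: one leg takes the arc to g 0 and goes up the path towards
    g h, the other one continues the path beyond g h. *)
Lemma dipath_spider m g h a b : dipath m g -> h <= m -> e (g h) (g 0) ->
  a <= h -> b <= m - h -> contains e (@path_bf a b).
Proof.
move=> [arc inj] le_hm eh0 le_ah le_bh.
exists (fun t : 'I_(a + b).+1 => g (if t < a then a.-1 - t else h + (t - a))).
split=> [t u /inj | t u].
  move: (ltn_ord t) (ltn_ord u) => lt_t lt_u eq_tu; apply: val_inj => /=.
  move: eq_tu; do ?case: ifPn; lia.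
move: (ltn_ord t) (ltn_ord u) => lt_t lt_u /orP[] /andP[] h1 /eqP h2.
  rewrite h2 h1; have [?|?] := ltnP u.+1 a.
    have -> : a.-1 - u = (a.-1 - u.+1).+1 by lia.
    by apply: arc; lia.
  have -> : h + (u.+1 - a) = h by lia.
  by have -> : a.-1 - u = 0 by lia.
rewrite h2 ltnNge h1 ltnNge (leq_trans h1) //= subSn // addnS.
by apply: arc; lia.
Qed.

Lemma contains_swap a b : contains e (@path_bf a b) -> contains e (@path_bf b a).
Proof.
move=> [f [injf arcf]].
have eqn : (b + a).+1 = (a + b).+1 by rewrite addnC.
exists (fun t => f (cast_ord eqn (rev_ord t))); split.
  by move=> t u /injf /cast_ord_inj /rev_ord_inj.
move=> t u tu; apply: arcf; move: (ltn_ord t) (ltn_ord u) tu.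
rewrite /path_bf /=; lia.
Qed.

(** * Longest paths have length at least twice the semidegree *)

Section Longest.
Variables (d m : nat).
Hypotheses (d_gt0 : 0 < d) (dout : forall x, d <= outdeg e x).
Hypotheses (din : forall x, d <= indeg e x).
Hypothesis maxm : forall g, ~ dipath m.+1 g.

Lemma on_path_or_not (g : nat -> T) x :
  (exists2 h, h <= m & x = g h) \/ (forall h, h <= m -> x <> g h).
Proof.
have [/mapP[h]|nx] := boolP (x \in [seq g h | h <- iota 0 m.+1]).
  by rewrite mem_iota => ? ->; left; exists h.
by right=> h le_hm eqx; case/negP: nx; rewrite eqx map_f // mem_iota.
Qed.

Lemma start_closed g x : dipath m g -> e x (g 0) -> exists2 h, h <= m & x = g h.
Proof.
move=> [arc inj] ex0; case: (on_path_or_not g x) => // nx.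
case: (maxm (fun n => if n is n'.+1 then g n' else x)); split.
  by case=> //= i; apply: arc.
move=> [|i] [|j] //= hi hj; first by move/(nx _ hj).
  by move/esym/(nx _ hi).
by move/inj => ->.
Qed.

Lemma end_closed g x : dipath m g -> e (g m) x -> exists2 h, h <= m & x = g h.
Proof.
move=> [arc inj] emx; case: (on_path_or_not g x) => // nx.
case: (maxm (fun n => if n <= m then g n else x)); split.
  move=> i; rewrite ltnS => le_im; rewrite le_im.
  case: ltnP => [/arc //|le_mi].
  by have -> : i = m by lia.
move=> i j ? ?; case: (leqP i m) => hi; case: (leqP j m) => hj; last by lia.
- exact: inj.
- by move/esym/(nx _ hi).
- by move/(nx _ hj).
Qed.

Lemma card_le_cnt (g : nat -> T) (p : pred T) :
    (forall x, p x -> exists2 h, h <= m & x = g h) ->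
  #|[set x | p x]| <= cnt (fun h => p (g h)) 0 m.+1.
Proof.
move=> pg; rewrite /cnt big_mkord -sum1dep_card big_mkcond /=.
have -> : \sum_(i < m.+1) p (g i) = #|[set i : 'I_m.+1 | p (g i)]|.
  rewrite -sum1dep_card [RHS]big_mkcond /=.
  by apply: eq_bigr => i _; case: (p _).
rewrite -big_mkcond sum1dep_card /=.
apply: leq_trans (leq_imset_card (fun i : 'I_m.+1 => g i) _).
apply/subset_leq_card/subsetP => x; rewrite inE => px.
have [h le_hm eqx] := pg x px; apply/imsetP.
by exists (Ordinal (le_hm : h < m.+1)); rewrite // inE -eqx.
Qed.

(** Rotating keeps the vertex set, so all in-neighbours of the start g (i+1) of
    the rotated path can be counted along the original path. *)
Lemma indeg_rot g i j : dipath m g -> j <= i < m -> e (g m) (g j) ->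
    (0 < j -> e (g i) (g 0)) ->
  d <= cnt (fun h => e (g h) (g i.+1)) 0 m.+1.
Proof.
move=> pg /andP[le_ji lt_im] emj ei0.
have le_jim : j <= i <= m by rewrite le_ji ltnW.
have pr := dipath_rot pg le_jim (fun _ => emj) ei0.
apply: leq_trans (din _) _.
apply: (card_le_cnt g (fun x => e x (g i.+1))) => x.
rewrite -(@rotidx0 m i j) ?le_ji // => /(start_closed _ _ pr)[h le_hm ->].
by exists (rotidx m i j h) => //; exact: rotidx_le.
Qed.

Lemma outdeg_rot g i j : dipath m g -> j < i <= m ->
    (i < m -> e (g m) (g j.+1)) -> e (g i) (g 0) ->
  d <= cnt (fun h => e (g j) (g h)) 0 m.+1.
Proof.
move=> pg le_jim emj ei0.
have pr := dipath_rot pg le_jim emj (fun _ => ei0).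
apply: leq_trans (dout _) _.
apply: (card_le_cnt g (e (g j))) => x.
have rm : rotidx m i j.+1 m = j by rewrite rotidxm //; lia.
rewrite -{1}rm => /(end_closed _ _ pr)[h le_hm ->].
by exists (rotidx m i j.+1 h) => //; exact: rotidx_le.
Qed.

Lemma indeg_start0 g : dipath m g -> d <= cnt (fun h => e (g h) (g 0)) 0 m.+1.
Proof.
move=> pg; apply: leq_trans (din _) _.
by apply: (card_le_cnt g (fun x => e x (g 0))) => x; exact: start_closed.
Qed.

Lemma outdeg_end0 g : dipath m g -> d <= cnt (fun h => e (g m) (g h)) 0 m.+1.
Proof.
move=> pg; apply: leq_trans (dout _) _.
by apply: (card_le_cnt g (e (g m))) => x; exact: end_closed.
Qed.

(** In- and out-neighbours of g r are distinct from each other and from g r, so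
    2 d of the remaining m vertices of the path are used. *)
Lemma start_and_end_2d_le g r : r <= m ->
    d <= cnt (fun h => e (g h) (g r)) 0 m.+1 ->
    d <= cnt (fun h => e (g r) (g h)) 0 m.+1 ->
  2 * d <= m.
Proof.
move=> le_rm dP dQ.
suff : cnt (fun h => e (g h) (g r)) 0 m.+1 + cnt (fun h => e (g r) (g h)) 0 m.+1
       <= m by lia.
by apply: (@cnt_exclusive _ _ m r); rewrite ?e_irr // => i /e_asym/negP.
Qed.

(** Let a be the last in-neighbour of g 0 and b the first out-neighbour of g m.
    If b <= i, g i -> g 0, g m -> g (i+2) and i + 2 <= a, then g (i+1) starts
    the rotation at (i, b) and ends the rotation at (a, i+2).  If b < 2 and
    b <= a, the vertex g 0 is in the same way an end as well as a start. *)
Lemma longest_ge_2d g : dipath m g -> 2 * d <= m.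
Proof.
move=> pg; have [arc inj] := pg; rewrite leqNgt; apply/negP => lt_md.
set P := fun h => (h <= m) && e (g h) (g 0).
set Q := fun h => (h <= m) && e (g m) (g h).
have dP : d <= cnt P 0 m.+1.
  apply: leq_trans (indeg_start0 _ pg) _; apply: eq_leq.
  by apply: eq_big_nat => i /=; rewrite ltnS /P => ->.
have dQ : d <= cnt Q 0 m.+1.
  apply: leq_trans (outdeg_end0 _ pg) _; apply: eq_leq.
  by apply: eq_big_nat => i /=; rewrite ltnS /Q => ->.
have exP : exists h, P h.
  by have [|h _] := @cnt_gt0 P 0 m.+1; [exact: leq_trans dP | exists h].
have exQ : exists h, Q h.
  by have [|h _] := @cnt_gt0 Q 0 m.+1; [exact: leq_trans dQ | exists h].
have Pm h : P h -> h <= m by case/andP.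
case: (ex_maxnP exP Pm) => a /andP[le_am ea0] maxa.
case: (ex_minnP exQ) => b /andP[le_bm emb] minb.
have m_gt0 : 0 < m.
  rewrite lt0n; apply/eqP => m0; move: emb; rewrite m0 in le_bm *.
  by have -> : b = 0 by [lia]; rewrite e_irr.
have P0 : ~~ P 0 by rewrite /P e_irr.
have P1 : ~~ P 1 by rewrite /P m_gt0 e_asym ?arc.
have Qm : ~~ Q m by rewrite /Q e_irr andbF.
have b_ge2 : b <= a -> 2 <= b.
  move=> le_ba; rewrite leqNgt; apply/negP => lt_b2.
  have am : b = 0 -> a = m.
    move=> b0; apply/eqP; rewrite eqn_leq le_am maxa //.
    by rewrite /P leqnn -b0.
  have a_gt0 : 0 < a by rewrite lt0n; apply/eqP => a0; rewrite a0 e_irr in ea0.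
  have dO : d <= cnt (fun h => e (g 0) (g h)) 0 m.+1.
    apply: (outdeg_rot _ a) => //; first by rewrite a_gt0.
    case: b lt_b2 emb am {le_bm minb le_ba} => [|[|//]] _ // _ /(_ erefl) ->.
    by rewrite ltnn.
  by have := start_and_end_2d_le g 0 (leq0n _) (indeg_start0 _ pg) dO; lia.
have lt_am : b <= a -> a < m.
  move=> /b_ge2 ?; rewrite ltn_neqAle le_am andbT; apply/eqP => am.
  by have := minb 0; rewrite /Q /= -{1}am ea0 => /(_ isT); lia.
have PQ i : b <= i -> i + 2 <= a -> P i -> Q (i + 2) -> False.
  move=> le_bi le_ia /andP[_ ei0] /andP[_ emi].
  have dI : d <= cnt (fun h => e (g h) (g i.+1)) 0 m.+1.
    by apply: (indeg_rot _ i b) => //; lia.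
  have dO : d <= cnt (fun h => e (g i.+1) (g h)) 0 m.+1.
    by apply: (outdeg_rot _ a) => //; [lia | rewrite -addn2].
  by have := start_and_end_2d_le g i.+1 _ dI dO; lia.
have a_ge2 : 2 <= a.
  case: a ea0 {maxa b_ge2 lt_am PQ} le_am => [|[|//]] h1 h2.
    by rewrite e_irr in h1.
  by rewrite /P h1 h2 in P1.
have b_gt0 : 0 < b by rewrite lt0n; apply/eqP => b0; lia.
suff : cnt P 0 m.+1 + cnt Q 0 m.+1 <= m by lia.
apply: (@cnt_interleaved P Q m a b) => //.
- move=> i Pi; rewrite maxa // andbT.
  by case: i Pi => [|[|]] // h; [case/negP: P0 | case/negP: P1].
- move=> i Qi; rewrite minb //= ltn_neqAle; case/andP: (Qi) => -> _.
  by rewrite andbT; apply/eqP => eqi; rewrite -eqi Qi in Qm.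
- by move=> le_ba; split; [apply: b_ge2 | apply: lt_am].
- by rewrite b_gt0.
- by rewrite a_ge2.
Qed.

(** * Longest paths in the absence of a spider *)

Section NoSpider.
Variables (l s : nat).
Hypotheses (s_gt0 : 0 < s) (le_sl : s <= l).
Hypotheses (d_k : 2 * (l + s) <= 3 * d) (d_ls : l + 2 * s <= 2 * d).
Hypothesis no_spider : ~ contains e (@path_bf l s).

(** Either leg of the spider centred at g h may play the role of the long one. *)
Lemma start_avoid g h : dipath m g -> h <= m -> e (g h) (g 0) ->
  ~ (s <= h <= m - l) /\ ~ (l <= h <= m - s).
Proof.
move=> pg le_hm eh0; split=> h_mid; apply: no_spider.
  by apply: contains_swap; apply: (dipath_spider _ _ _ _ _ pg le_hm eh0); lia.
by apply: (dipath_spider _ _ _ _ _ pg le_hm eh0); lia.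
Qed.

(** When m + 1 < 2 l the allowed positions are the s - 1 positive ones below s,
    the 2 l - m - 1 ones strictly between m - l and l, and the last s. *)
Lemma longest_ge_2l g : dipath m g -> 2 * l <= m.+1.
Proof.
move=> pg; have md := longest_ge_2d g pg; rewrite leqNgt; apply/negP => lt_ml.
have := indeg_start0 g pg; set P := fun h => _ => dP.
have P0 : ~~ P 0 by rewrite /P e_irr.
have Z1 : cnt P s (m - l).+1 = 0.
  apply: cnt_eq0 => i hi; apply/negP => Pi.
  by have [] := start_avoid g i pg _ Pi; lia.
have Z2 : cnt P l (m - s).+1 = 0.
  apply: cnt_eq0 => i hi; apply/negP => Pi.
  by have [] := start_avoid g i pg _ Pi; lia.
have := cnt_cat P 0 s m.+1; have := cnt_cat P s (m - l).+1 m.+1.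
have := cnt_cat P (m - l).+1 l m.+1; have := cnt_cat P l (m - s).+1 m.+1.
have := @cnt_lt P 0 s 0 s_gt0 P0; have := cnt_le P (m - l).+1 l.
have := cnt_le P (m - s).+1 m.+1.
lia.
Qed.

(** Once 2 l <= m + 1, the two forbidden intervals of [start_avoid] cover
    [s, m - s]. *)
Lemma start_avoid_mid g h : dipath m g -> s <= h <= m - s -> ~~ e (g h) (g 0).
Proof.
move=> pg h_mid; apply/negP => eh0.
have ml := longest_ge_2l g pg; have md := longest_ge_2d g pg.
by have [] := start_avoid g h pg _ eh0; lia.
Qed.

(** On a closed path every vertex can be taken as start, so arcs of cyclic length
    strictly between s and m - s + 1 are excluded in both directions: the 2 d
    neighbours of g 0 lie among 1 .. s and m - s + 1 .. m. *)
Lemma not_hamiltonian g : dipath m g -> ~~ e (g m) (g 0).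
Proof.
move=> pg; apply/negP => em0; have md := longest_ge_2d g pg.
have dI := indeg_start0 g pg.
have dO : d <= cnt (fun h => e (g 0) (g h)) 0 m.+1.
  by apply: (outdeg_rot g m) => //; lia.
set I := fun h => _ in dI; set O := fun h => _ in dO.
have I0 : cnt I s.+1 (m - s).+1 = 0.
  by apply: cnt_eq0 => i hi; apply: start_avoid_mid => //; lia.
have O0 : cnt O s.+1 (m - s).+1 = 0.
  apply: cnt_eq0 => i hi; apply/negP => Oi.
  (* The cycle is opened at g i, which puts g 0 at position m - i + 1. *)
  have pr : dipath m (g \o rotidx m m i).
    by apply: (dipath_rot pg) => //; [lia | rewrite ltnn].
  have := start_avoid_mid _ (m - i).+1 pr.
  have -> : (g \o rotidx m m i) (m - i).+1 = g 0.
    by congr (g _); rewrite /rotidx; do ?case: ifPn; lia.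
  have -> : (g \o rotidx m m i) 0 = g i.
    by congr (g _); rewrite /rotidx; do ?case: ifPn; lia.
  by rewrite -/(O i) Oi; lia.
have IO a b : cnt I a b + cnt O a b <= b - a.
  have := @cnt_disjoint I O a b 0; rewrite !addn0; apply=> i _.
  by rewrite addn0 => /e_asym/negP.
have I00 : cnt I 0 1 = 0 by apply: cnt_eq0 => -[|//]; rewrite /I e_irr.
have O00 : cnt O 0 1 = 0 by apply: cnt_eq0 => -[|//]; rewrite /O e_irr.
have := cnt_cat I 0 1 m.+1; have := cnt_cat I 1 s.+1 m.+1.
have := cnt_cat O 0 1 m.+1; have := cnt_cat O 1 s.+1 m.+1.
have := cnt_cat I s.+1 (m - s).+1 m.+1; have := cnt_cat O s.+1 (m - s).+1 m.+1.
have := IO 1 s.+1; have := IO (m - s).+1 m.+1.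
lia.
Qed.

Lemma no_spider_no_longest g : ~ dipath m g.
Proof.
move=> pg; have [arc _] := pg; have md := longest_ge_2d g pg.
have := indeg_start0 g pg; set P := fun h => _ => dP.
have := outdeg_end0 g pg; set Q := fun h => _ => dQ.
have nP0 : ~~ P 0 by rewrite /P e_irr.
have nQm : ~~ Q m by rewrite /Q e_irr.
have nQ0 : ~~ Q 0 := not_hamiltonian g pg.
have P_last : d < cnt P (m.+1 - s) m.+1 + s.
  have := cnt_cat P 0 s m.+1; have := cnt_cat P s (m.+1 - s) m.+1.
  have := @cnt_lt P 0 s 0 s_gt0 nP0.
  have : cnt P s (m.+1 - s) = 0.
    by apply: cnt_eq0 => i hi; apply: start_avoid_mid => //; lia.
  lia.
(* Rotating at (i, j), for an in-neighbour g i of g 0 near the end, gives a path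
   whose start has g i as in-neighbour at position m - j. *)
have Q_mid j : s <= j <= m - s -> ~~ Q j.
  move=> j_mid; apply/negP => Qj.
  have [|i i_last Pi] := @cnt_gt0 P (m.+1 - s) m.+1; first by lia.
  have pr : dipath m (g \o rotidx m i j) by apply: (dipath_rot pg) => //; lia.
  have := start_avoid_mid _ (m - j) pr.
  have -> : (g \o rotidx m i j) (m - j) = g i.
    by congr (g _); rewrite /rotidx; do ?case: ifPn; lia.
  case: (ltngtP i m) i_last => [lt_im|?|->] i_last; last 1 first.
  - have -> : (g \o rotidx m m j) 0 = g j.
      by congr (g _); rewrite /rotidx; do ?case: ifPn; lia.
    by rewrite -/(Q j) Qj; lia.
  - by rewrite /= rotidx0 ?arc //; lia.
  by lia.
have Q_first : d < cnt Q 0 s + s.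
  have := cnt_cat Q 0 s m.+1; have := cnt_cat Q s (m.+1 - s) m.+1.
  have := @cnt_lt Q (m.+1 - s) m.+1 m _ nQm.
  have : cnt Q s (m.+1 - s) = 0.
    by apply: cnt_eq0 => i hi; apply: Q_mid; lia.
  lia.
have [t lt_ts [Pt Qt]] :
    exists2 t, 0 <= t < s & P (m - t) /\ Q (t + 0).
  apply: (@cnt_meet (fun t => P (m - t))); rewrite !addn0.
  by rewrite -cnt_rev; lia.
rewrite addn0 in Qt.
have t_gt0 : 0 < t by rewrite lt0n; apply: contraNneq nQ0 => <-.
have lt_im : t <= m - t < m by lia.
have pr : dipath m (g \o rotidx m (m - t) t) by apply: (dipath_rot pg) => //; lia.
have := indeg_rot g (m - t) t pg lt_im Qt (fun _ => Pt).
set E := fun h => _ => dE.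
(* As i = m - t and j = t, rotation fixes all positions between t and m - t. *)
have E_mid h : s <= h <= m - s -> ~~ E h.
  move=> h_mid; have := start_avoid_mid _ h pr h_mid.
  rewrite /= rotidx0 //; have -> // : rotidx m (m - t) t h = h.
  by rewrite /rotidx; do ?case: ifPn; lia.
(* The last s positions count at most s - 1, since m - t + 1 is one of them and
   is excluded; position s - 1 is dropped because q ranges below it. *)
have E_first : d <= cnt E 0 s.-1 + s.
  have := cnt_cat E 0 s.-1 m.+1; have := cnt_cat E s.-1 s m.+1.
  have := cnt_cat E s (m.+1 - s) m.+1; have := cnt_le E s.-1 s.
  have := @cnt_lt E (m.+1 - s) m.+1 (m - t).+1 _ (negbT (e_irr _)).
  have : cnt E s (m.+1 - s) = 0.
    by apply: cnt_eq0 => i hi; apply: E_mid; lia.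
  lia.
have Q_from1 : d < cnt Q 1 s + s.
  have := cnt_cat Q 0 1 s.
  by have := @cnt_lt Q 0 1 0 isT nQ0; lia.
have [q lt_qs [Eq Qq]] : exists2 q, 0 <= q < s.-1 & E q /\ Q (q + 1).
  apply: cnt_meet; have -> : s.-1 + 1 = s by lia.
  by rewrite add0n; lia.
rewrite addn1 in Qq.
(* Rotating at (m - t, q + 1) gives a path from g (m - t + 1) to g q. *)
have pr' : dipath m (g \o rotidx m (m - t) q.+1) by apply: (dipath_rot pg) => //; lia.
have /negP[] := not_hamiltonian _ pr'.
by rewrite /= rotidx0 ?rotidxm //; lia.
Qed.

End NoSpider.
End Longest.
End Paths.

(** * The theorem *)

(** Without a spider every directed path can be exceeded in length, which is
    impossible in a finite graph. *)
Lemma semidegree_path_bf (T : finType) (e : rel T) (x0 : T) (l s d : nat) :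
    irreflexive e -> (forall x y, e x y -> ~~ e y x) ->
    (forall x, d <= outdeg e x) -> (forall x, d <= indeg e x) ->
    0 < s <= l -> 2 * (l + s) <= 3 * d -> l + 2 * s <= 2 * d ->
  contains e (@path_bf l s).
Proof.
move=> irr asym dout din /andP[s_gt0 le_sl] dk dls.
apply: NNPP => no_spider.
have d_gt0 : 0 < d by lia.
have long m : exists g, dipath T e m g.
  elim: m => [|m [g pg]].
    by exists (fun=> x0); split=> // i j; rewrite !leqn0 => /eqP-> /eqP->.
  apply: NNPP => maxm.
  have maxm' g' : ~ dipath T e m.+1 g' by move=> pg'; apply: maxm; exists g'.
  exact: (no_spider_no_longest T e irr asym d m d_gt0 dout din maxm' l s s_gt0 le_sl
            dk dls no_spider g pg).
have [g [_ injg]] := long #|T|.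
have /leq_card : injective (fun i : 'I_#|T|.+1 => g i).
  by move=> i j /injg eq_ij; apply/val_inj/eq_ij; rewrite -ltnS.
by rewrite card_ord ltnn.
Qed.

Lemma contains_rev (T : finType) (e : rel T) l s :
  contains (fun x y => e y x) (@path_bf l s) -> contains e (@path_fb l s).
Proof. by move=> [f [injf arcf]]; exists f; split=> // u v /arcf. Qed.

Import Order.TTheory GRing.Theory Num.Theory.

Lemma min_semidegree_le (T : finType) (e : rel T) x :
  min_semidegree e <= indeg e x /\ min_semidegree e <= outdeg e x.
Proof.
rewrite /min_semidegree; set D := \big[_/_]_(_ : T) _.
have : (D <= Order.min (indeg e x) (outdeg e x))%O by exact: bigmin_le_cond.
by rewrite le_min !leEnat => /andP.
Qed.

Local Open Scope ring_scope.

Theorem theorem1p2 (k l : nat) (k_gt0 : (0 < k)%N) (l_gt0 : (0 < l)%N)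
    (k2_le_l : k%:R / 2 <= l%:R :> rat) (l_lt_k : (l < k)%N)
    (T : finType) (T_gt0 : (0 < #|T|)%N) (e : rel T) (e_or : oriented_graph e)
    (deg_e : (if l%:R <= 2 * k%:R / 3 :> rat then k%:R - l%:R / 2
              else 2 * k%:R / 3) <= (min_semidegree e)%:R :> rat) :
  contains e (@path_bf l (k - l)) /\ contains e (@path_fb l (k - l)).
Proof.
have [irr asym] := e_or; set d := min_semidegree e in deg_e.
have le_k2l : (k <= 2 * l)%N.
  by rewrite -(ler_nat rat) natrM; lra.
have [le_2k3d le_2kl2d] : (2 * k <= 3 * d)%N /\ (2 * k <= 2 * d + l)%N.
  rewrite -!(ler_nat rat) natrD !natrM.
  by move: deg_e; case: ifPn => [h1 h2|]; [|rewrite -ltNge => h1 h2]; split; lra.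
have /card_gt0P[x0 _] := T_gt0.
have dout x : (d <= outdeg e x)%N by case: (min_semidegree_le T e x).
have din x : (d <= indeg e x)%N by case: (min_semidegree_le T e x).
split; last apply: contains_rev; apply: (semidegree_path_bf _ _ x0 _ _ d);
  by [exact: irr | exact: asym | move=> x y /asym | exact: dout | exact: din | lia].
Qed.
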